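(* If an $n$-cycle $C \in \mathcal{C}_n$ has fewer than $n-2$ non-$\mu$-matches, then $C$ is incontractible.
   Context: $\mathcal{C}_n$ is the set of $n$-cycles in the symmetric group $S_n$. An $n$-cycle is written $C=(c_0,c_1,\dots,c_{n-1})$ with $c_0=1$, viewed as a cyclic arrangement of $\{1,\dots,n\}$. We say $c_s$ is cyclically between $c_i$ and $c_j$ if $i<s<j$, or $j<i<s$, or $s<j<i$. A pair $\langle a,b\rangle$ with $1\le a<b\le n$ is a non-$\mu$-match of $C$ if there exists an integer $x$ with $a<x<b$ that is cyclically between $a$ and $b$ in $C$. $C$ is incontractible if there is no $i$ with $1\le i\le n-1$ such that $i+1$ immediately follows $i$ in $C$. *)

(* Defs.v *)
From mathcomp Require Import all_boot all_fingroup.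

Set Implicit Arguments.
Unset Strict Implicit.
Unset Printing Implicit Defensive.

(* The letter k of {1, ..., n} is encoded as the element of
   'I_n with value k - 1, so the letter 1 is the ordinal 0. *)

(* The unique orbit is everything; no permutation of 'I_0 is a 0-cycle. *)
Definition is_ncycle (n : nat) (C : 'S_n) : bool :=
  porbits C == [set [set: 'I_n]].

(* [:: c_0; ...; c_(n-1)] with c_0 the letter 1 and c_(i+1) = C c_i. *)
Definition cycle_word (n : nat) : 'S_n -> seq 'I_n :=
  if n is m.+1 then fun C => traject C ord0 m.+1 else fun=> [::].

Definition cycle_pos (n : nat) (C : 'S_n) (x : 'I_n) : nat :=
  index x (cycle_word C).

(* x is cyclically between a and b in C. *)
Definition cyc_between (n : nat) (C : 'S_n) (a x b : 'I_n) : bool :=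
  let i := cycle_pos C a in
  let s := cycle_pos C x in
  let j := cycle_pos C b in
  [|| i < s < j, j < i < s | s < j < i].

Definition non_mu_match (n : nat) (C : 'S_n) (a b : 'I_n) : bool :=
  (a < b) && [exists x : 'I_n, (a < x < b) && cyc_between C a x b].

Definition non_mu_matches (n : nat) (C : 'S_n) : {set 'I_n * 'I_n} :=
  [set p | non_mu_match C p.1 p.2].

(* The bound i <= n - 1 on letters is automatic, since C i is again a letter. *)
Definition incontractible (n : nat) (C : 'S_n) : Prop :=
  ~ exists i : 'I_n, C i = i.+1 :> nat.

(* Main.v *)
Require Import Defs.
From mathcomp Require Import all_boot all_fingroup.
From mathcomp Require Import zify.

(** If [C i = i + 1], then [i + 1] witnesses that [<i, b>] is a non-mu-match
    for every [b > i + 1], and [i] witnesses that [<a, i + 1>] is one for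
    every [a < i]; these are [n - 2] distinct pairs. *)

Section CyclePositions.

Variables (m : nat) (C : 'S_m.+1).
Hypothesis hC : is_ncycle C.

Lemma porbit_ncycle (x : 'I_m.+1) : porbit C x = [set: 'I_m.+1].
Proof.
by apply/set1P; rewrite -(eqP hC); apply: imset_f.
Qed.

Lemma card_porbit_ncycle (x : 'I_m.+1) : #|porbit C x| = m.+1.
Proof. by rewrite porbit_ncycle cardsT card_ord. Qed.

(** The word runs once through the orbit of [ord0], which is the whole of ['I_m.+1]. *)
Lemma mem_cycle_word (x : 'I_m.+1) : x \in cycle_word C.
Proof.
have := porbit_traject C ord0 x.
by rewrite card_porbit_ncycle porbit_ncycle inE => <-.
Qed.

Lemma uniq_cycle_word : uniq (cycle_word C).
Proof. by have := uniq_traject_porbit C ord0; rewrite card_porbit_ncycle. Qed.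

Lemma cycle_pos_lt (x : 'I_m.+1) : cycle_pos C x < m.+1.
Proof. by have := mem_cycle_word x; rewrite -index_mem size_traject. Qed.

Lemma iter_cycle_pos (x : 'I_m.+1) : iter (cycle_pos C x) C ord0 = x.
Proof.
by rewrite -(nth_traject _ (cycle_pos_lt x)) nth_index // mem_cycle_word.
Qed.

Lemma cycle_pos_inj : injective (cycle_pos C).
Proof. by move=> x y exy; rewrite -(iter_cycle_pos x) exy iter_cycle_pos. Qed.

Lemma cycle_pos_iter (k : nat) :
  k < m.+1 -> cycle_pos C (iter k C ord0) = k.
Proof.
move=> ltk; rewrite -(nth_traject _ ltk).
by apply: index_uniq uniq_cycle_word; rewrite size_traject.
Qed.

Lemma cycle_pos_next (x : 'I_m.+1) :
  cycle_pos C (C x) =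
    if cycle_pos C x == m then 0 else (cycle_pos C x).+1.
Proof.
rewrite -{1}(iter_cycle_pos x) -iterS.
have := cycle_pos_lt x; rewrite ltnS leq_eqVlt.
case: eqP => [-> _ | _ /= ltm]; last first.
  exact: (cycle_pos_iter (cycle_pos C x).+1).
(* From the last position [m], one more step makes [m.+1] iterations, the size of the orbit, and so
   returns to [ord0]. *)
have := iter_porbit C ord0; rewrite card_porbit_ncycle => ->.
exact: (cycle_pos_iter 0).
Qed.

(** Nothing fits between [a] and its successor, so any third letter [x] gives the cyclic order [a],
    [C a], [x]; the two conclusions are rotations of it. *)
Lemma cyc_between_next (a x : 'I_m.+1) :
  C a != a -> x != a -> x != C a ->
  cyc_between C a (C a) x && cyc_between C x a (C a).
Proof.
rewrite -!(inj_eq cycle_pos_inj) /cyc_between cycle_pos_next.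
have := cycle_pos_lt a; have := cycle_pos_lt x.
(* The case split separates the wrap-around, where [C a] has position 0. *)
by case: (cycle_pos C a =P m); lia.
Qed.

End CyclePositions.

Theorem lemma16 (n : nat) (C : 'S_n) (hC : is_ncycle C)
  (hlt : #|non_mu_matches C| < n - 2) :
  incontractible C.
Proof.
case: n C hC hlt => [|m] C hC hlt [i Ci]; first by case: i Ci.
move: hlt; apply/negP; rewrite -leqNgt.
have neCi : C i != i by rewrite -val_eqE /= Ci; lia.
pose D := ~: [set i; C i].
pose f (x : 'I_m.+1) := if i < x then (i, x) else (x, C i).
(* If the two branches of [f] gave the same pair, its second component would put [C i] in [D]. *)
have injf : {in D &, injective f}.
  move=> x y; rewrite !inE !negb_or => /andP[_ /eqP nx] /andP[_ /eqP ny].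
  by rewrite /f; case: ifP => _; case: ifP => _ [*]; congruence.
have cardD : #|D| = m.+1 - 2.
  by rewrite cardsCs setCK card_ord cards2 eq_sym neCi.
rewrite -cardD -(card_in_imset injf); apply/subset_leq_card/subsetP => p.
case/imsetP=> x; rewrite !inE negb_or => /andP[nxi nxCi] ->.
have /andP[bi bx] := cyc_between_next _ _ hC _ _ neCi nxi nxCi.
move: nxi nxCi; rewrite -!val_eqE /= Ci => nxi nxCi.
rewrite /f /non_mu_match; case: (ltnP i x) => ix /=.
  by rewrite ix; apply/existsP; exists (C i); rewrite bi andbT Ci; lia.
(* Here [x <= i] and [x != i], so [i] lies strictly between [x] and [C i]. *)
have ltx : x < C i by rewrite Ci; lia.
by rewrite ltx; apply/existsP; exists i; rewrite bx andbT Ci; lia.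
Qed.
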